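(* The digital shearlet system $$\mathcal{DSH}=\{\varphi_n^{\iota_0}:\iota_0=1,2,\ n\in\mathcal R\}\cup\{\sigma^{\iota}_{j,s,m}: j\in\{j_L,\dots,j_H\},\ s\in\{-2^j,\dots,2^j\},\ m\in\mathcal R_{j,s},\ \iota=11,12,21,22\}$$ forms a tight frame for functions $J:\Omega_R\to\mathbb{C}$; that is, for every $J:\Omega_R\to\mathbb{C}$, $$\sum_{\iota_0,n}|\langle J,\varphi_n^{\iota_0}\rangle_{\Omega_R}|^2+\sum_{\iota,j,s,m}|\langle J,\sigma^\iota_{j,s,m}\rangle_{\Omega_R}|^2=\langle J,J\rangle_{\Omega_R}.$$
   Context: **Grid.** $R$ and $N$ are positive even integers with $N=2^{n_0}$, $n_0\in\mathbb{N}$. The pseudo-polar grid is $\Omega_R=\Omega_R^1\cup\Omega_R^2$, where, with $k,\ell$ integers, $$\Omega_R^1=\{(-\tfrac{2k}{R}\cdot\tfrac{2\ell}{N},\tfrac{2k}{R}):-\tfrac N2\le\ell\le\tfrac N2,\ -\tfrac{RN}{2}\le k\le\tfrac{RN}{2}\},\qquad\Omega_R^2=\{(\tfrac{2k}{R},-\tfrac{2k}{R}\cdot\tfrac{2\ell}{N}):-\tfrac N2\le\ell\le\tfrac N2,\ -\tfrac{RN}{2}\le k\le\tfrac{RN}{2}\}.$$ $\Omega_R^{11},\Omega_R^{21}$ (resp. $\Omega_R^{12},\Omega_R^{22}$) are the parts of $\Omega_R^1,\Omega_R^2$ with $1\le k\le\frac{RN}2$ (resp. $-\frac{RN}2\le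 k\le-1$). The center $\mathcal C=\{(0,0)\}$ appears $N+1$ times in $\Omega_R^1$ and $N+1$ times in $\Omega_R^2$ (as $k=0$, $\ell=-\frac N2,\dots,\frac N2$). The points $(\omega_x,\omega_y)\neq(0,0)$ of the seam lines, $|\omega_x|=|\omega_y|$, appear in both $\Omega_R^1$ and $\Omega_R^2$. The inner product of $f,g:\Omega_R\to\mathbb{C}$ is $\langle f,g\rangle_{\Omega_R}=\sum_{x\in\Omega_R}f(x)\overline{g(x)}$. In $\langle J,J\rangle_{\Omega_R}$ every point counts once, whereas for the functions $\varphi_n^{\iota_0}$ below (which are supported on $\Omega_R^{\iota_0}$) the sum over $\Omega_R^{\iota_0}$ is taken over the index pairs $(k,\ell)$, so that the origin enters once for each $\ell$. Put $$C(\omega_x,\omega_y)=\begin{cases}1,&(\omega_x,\omega_y)\text{ not on a seam line},\\ \frac1{\sqrt2},&(\omega_x,\omega_y)\ne(0,0)\text{ on a seam line},\\ \frac1{\sqrt{2(N+1)}},&(\omega_x,\omega_y)=(0,0).\end{cases}$$ **Windows.** $j_L=-\lceil\log_4(R/2)\rceil$, $j_H=\lceil\log_4N\rceil$. $W_0$ is the Fourier transform of the Meyer scaling function, with $\operatorname{supp}W_0\subseteq[-1,1]$ and $W_0(\pm1)=0$. $W$ is the Fourier transform of the Meyer wavelet function, with $\operatorname{supp}W\subseteq[-4,-\frac14]\cup[\frac14,4]$, $W(\pm\frac14)=W(\pm4)=0$, and $$|W_0(4^{-j_L}\xi)|^2+\sum_{j=j_L}^{j_H}|W(4^{-j}\xi)|^2=1\quad\text{for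 all }|\xi|\le N,\ \xi\in\mathbb{R}.$$ $V_0$ is a bump function with $\operatorname{supp}V_0\subseteq[-\frac32,\frac32]$ and $V_0(\xi)=1$ for $|\xi|\le1$. $V$ is a bump function with $\operatorname{supp}V\subseteq[-1,1]$, $V(\pm1)=0$, and $|V(\xi-1)|^2+|V(\xi)|^2+|V(\xi+1)|^2=1$ for $|\xi|\le1$. Put $V^j=V$ for $j\ge0$ and $V^j=V_0$ for $j<0$. The scaling function $\phi$ is given by $$\hat\phi(\xi_1,\xi_2)=W_0(4^{-j_L}\xi_1)V_0(4^{-j_L}\xi_2),\quad(\xi_1,\xi_2)\in\mathbb{R}^2,$$ and is restricted to the pseudo-polar grid. **Index sets.** The shears at scale $j\ge0$ are the integers $s\in\{-2^j,\dots,2^j\}$; for $j<0$ only $s=0$ is used. The numbers of sampling points in radial and angular direction affected by the window at scale $j$ and shear $s$ are $$\mathcal L^1_j=\begin{cases}4^{j+1}\frac R2,&j=j_L,\\4^{j-1}\cdot\frac{15R}2+1,&j_L<j<j_H,\\ \frac{RN}2-4^{j-1}\frac R2+1,&j=j_H,\end{cases}\qquad\mathcal L^2_{j,s}=\begin{cases}2^{-j}N+1,&-2^j<s<2^j,\ j\ge0,\\2^{-j}\frac N2+1,&s\in\{-2^j,2^j\},\ j\ge0,\\N+1,&j<0.\end{cases}$$ Let $$\mathcal R_{j,s}=\{((\mathcal L^1_j)^{-1}4^j\tfrac R2\cdot r_1,\,-(\mathcal L^2_{j,s})^{-1}\tfrac N{2^{j+1}}\cdot r_2):r_1=0,\dots,\mathcal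 L^1_j-1,\ r_2=0,\dots,\mathcal L^2_{j,s}-1\},$$ $$\mathcal R=\{(r_1,r_2):r_1=-1,\dots,1,\ r_2=-\tfrac N2,\dots,\tfrac N2\}.$$ **Digital shearlets.** On the cone $\Omega_R^{21}$, for $j\in\{j_L,\dots,j_H\}$, shear $s$ and $m\in\mathcal R_{j,s}$, $$\sigma^{21}_{j,s,m}(\omega_x,\omega_y)=\tfrac{C(\omega_x,\omega_y)}{\sqrt{|\mathcal R_{j,s}|}}\,W(4^{-j}\omega_x)\,V^j\big(s+2^j\tfrac{\omega_y}{\omega_x}\big)\chi_{\Omega_R^{21}}(\omega_x,\omega_y)\,e^{2\pi i\langle m,(4^{-j}\omega_x,\,2^j\frac{\omega_y}{\omega_x})\rangle}.$$ The shearlets on the other cones are defined accordingly by symmetry, with the same index sets: $\sigma^{22}_{j,s,m}(\omega_x,\omega_y)=\sigma^{21}_{j,s,m}(-\omega_x,-\omega_y)$, $\sigma^{11}_{j,s,m}(\omega_x,\omega_y)=\sigma^{21}_{j,s,m}(\omega_y,\omega_x)$, $\sigma^{12}_{j,s,m}(\omega_x,\omega_y)=\sigma^{21}_{j,s,m}(-\omega_y,-\omega_x)$. For $\iota_0=1,2$ and $n\in\mathcal R$, $$\varphi_n^{\iota_0}(\omega_x,\omega_y)=\tfrac{C(\omega_x,\omega_y)}{\sqrt{|\mathcal R|}}\,\hat\phi(\omega_x,\omega_y)\,\chi_{\Omega_R^{\iota_0}}(\omega_x,\omega_y)\,e^{2\pi i\langle n,(\frac k3,\frac\ell{N+1})\rangle},$$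 where $(k,\ell)$ are the indices of the point $(\omega_x,\omega_y)$ in the description of $\Omega_R^{\iota_0}$ above.
   Formalization: On the cone Ω_R^1, φ̂ is evaluated at (ω_y,ω_x) instead of (ω_x,ω_y), since the literal identity fails for R=2 with J the indicator of (0,1); and the numbers L^1_j, L^2_{j,s} are replaced by their integer parts where the formulas are not integers (e.g. R=4, j=0). *)

(* Defs.v *)
From HB Require Import structures.
From mathcomp Require Import all_boot all_order all_algebra.
From mathcomp Require Import finmap complex.
From mathcomp Require Import all_classical all_reals all_analysis.

Set Implicit Arguments.
Unset Strict Implicit.
Unset Printing Implicit Defensive.

Import Order.TTheory GRing.Theory Num.Theory.
Import numFieldNormedType.Exports.

Local Open Scope fset_scope.
Local Open Scope classical_set_scope.
Local Open Scope ring_scope.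
Local Open Scope complex_scope.

(* Throughout, K is the field of real numbers, R and N are the parameters of
   the pseudo-polar grid, and points of the plane are pairs in K * K. Sums over
   sets are finitely supported sums; all the sets summed over are finite. *)

Definition supp (K : realType) (T : nmodType) (f : K -> T) : set K :=
  closure [set x | f x != 0].

Definition bump_function (K : realType) (f : K -> K) : Prop :=
  (forall (n : nat) (x : K), derivable (derive1n n f) x 1) /\
  compact (supp f).

Definition expi2pi (K : realType) (t : K) : K[i] :=
  cos (2 * pi * t) +i* sin (2 * pi * t).

Definition cardset (T : choiceType) (A : set T) : nat := #|` fset_set A|.

Definition swap (K : realType) (x : K * K) : K * K := (x.2, x.1).

Variant cone := cone1 | cone2.

Definition grid_point (K : realType) (R N : nat) (i : cone) (k l : int)
    : K * K :=
  let r : K := 2 * k%:~R / R%:R in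
  let t : K := 2 * l%:~R / N%:R in
  match i with
  | cone1 => (- (r * t), r)
  | cone2 => (r, - (r * t))
  end.

Definition radial (R N : nat) : set int :=
  [set k : int | - ((R * N) %/ 2)%N%:Z <= k <= ((R * N) %/ 2)%N%:Z].

Definition angular (N : nat) : set int :=
  [set l : int | - (N %/ 2)%N%:Z <= l <= (N %/ 2)%N%:Z].

Definition Omega_cone (K : realType) (R N : nat) (i : cone) : set (K * K) :=
  [set grid_point K R N i k l | k in radial R N & l in angular N].
Arguments Omega_cone : clear implicits.

Definition Omega (K : realType) (R N : nat) : set (K * K) :=
  Omega_cone K R N cone1 `|` Omega_cone K R N cone2.
Arguments Omega : clear implicits.

Definition Omega21 (K : realType) (R N : nat) : set (K * K) :=
  [set grid_point K R N cone2 k l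
     | k in [set k : int | 1 <= k <= ((R * N) %/ 2)%N%:Z] & l in angular N].
Arguments Omega21 : clear implicits.

Definition weight (K : realType) (N : nat) (x : K * K) : K :=
  if x == (0, 0) then (Num.sqrt (2 * (N%:R + 1)))^-1
  else if `|x.1| == `|x.2| then (Num.sqrt 2)^-1
  else 1.

(* Every point of the grid counts once. *)
Definition inner (K : realType) (R N : nat) (f g : K * K -> K[i]) : K[i] :=
  \sum_(x \in Omega K R N) f x * (g x)^*.

(* Here the second function is given by its values on the index pairs of one
   cone, so that the origin enters once for each l. *)
Definition inner_cone (K : realType) (R N : nat) (i : cone)
    (f : K * K -> K[i]) (g : int -> int -> K[i]) : K[i] :=
  \sum_(k \in radial R N) \sum_(l \in angular N)
    f (grid_point K R N i k l) * (g k l)^*.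

Definition log4 (K : realType) (x : K) : K := ln x / ln 4.

Definition jL (K : realType) (R : nat) : int :=
  - Num.ceil (log4 (R%:R / 2 : K)).

Definition jH (K : realType) (N : nat) : int := Num.ceil (log4 (N%:R : K)).

Definition scales (K : realType) (R N : nat) : set int :=
  [set j : int | jL K R <= j <= jH K N].

Definition shears (j : int) : set int :=
  if 0 <= j then [set s : int | - (2 ^ j) <= s <= 2 ^ j] else [set 0].

(* For some R and N (for instance R = 4, or N = 2) the defining formulas give
   values that are not integers at some scale. The numbers of sampling points
   are then their integer parts. *)
Definition L1 (K : realType) (R N : nat) (j : int) : nat :=
  Num.truncn (if j == jL K R then 4 ^ (j + 1) * (R%:R / 2)
              else if j == jH K N then
                R%:R * N%:R / 2 - 4 ^ (j - 1) * (R%:R / 2) + 1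
              else 4 ^ (j - 1) * (15 * R%:R / 2) + 1 : K).

Definition L2 (K : realType) (N : nat) (j s : int) : nat :=
  Num.truncn (if j < 0 then N%:R + 1
              else if `|s| == 2 ^ j then 2 ^ (- j) * (N%:R / 2) + 1
              else 2 ^ (- j) * N%:R + 1 : K).

Definition Rjs (K : realType) (R N : nat) (j s : int) : set (K * K) :=
  [set ((L1 K R N j)%:R^-1 * 4 ^ j * (R%:R / 2) * r1%:R,
        - ((L2 K N j s)%:R^-1 * (N%:R / 2 ^ (j + 1)) * r2%:R))
     | r1 in `I_(L1 K R N j) & r2 in `I_(L2 K N j s)].
Arguments Rjs : clear implicits.

Definition Rlow (N : nat) : set (int * int) :=
  [set n : int * int | -1 <= n.1 <= 1 /\
                       - (N %/ 2)%N%:Z <= n.2 <= (N %/ 2)%N%:Z].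

(* The second digit is 1 for the part with k >= 1 and 2 for k <= -1. *)
Variant halfcone := cone11 | cone12 | cone21 | cone22.

Definition to_cone21 (K : realType) (i : halfcone) (x : K * K) : K * K :=
  match i with
  | cone21 => x
  | cone22 => (- x.1, - x.2)
  | cone11 => swap x
  | cone12 => (- x.2, - x.1)
  end.

Definition sigma21 (K : realType) (R N : nat) (W : K -> K[i]) (V0 V : K -> K)
    (j s : int) (m : K * K) (x : K * K) : K[i] :=
  let Vj := if 0 <= j then V else V0 in
  (weight N x / Num.sqrt (cardset (Rjs K R N j s))%:R)%:C
  * W (4 ^ (- j) * x.1) * (Vj (s%:~R + 2 ^ j * (x.2 / x.1)))%:C
  * (\1_(Omega21 K R N) x)%:C
  * expi2pi (m.1 * (4 ^ (- j) * x.1) + m.2 * (2 ^ j * (x.2 / x.1))).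

Definition sigma (K : realType) (R N : nat) (W : K -> K[i]) (V0 V : K -> K)
    (i : halfcone) (j s : int) (m : K * K) (x : K * K) : K[i] :=
  sigma21 R N W V0 V j s m (to_cone21 i x).

Definition phihat (K : realType) (R : nat) (W0 : K -> K[i]) (V0 : K -> K)
    (xi : K * K) : K[i] :=
  W0 (4 ^ (- jL K R) * xi.1) * (V0 (4 ^ (- jL K R) * xi.2))%:C.

(* The first argument of phihat is the radial variable, which is the first
   coordinate on cone2 and the second one on cone1: as for the shearlets, the
   functions on cone1 come from those on cone2 by exchanging the coordinates.
   Without this exchange on cone1 the system would not be a tight frame: for
   R = 2 the point (0, 1) would carry the extra mass |W0 0 * V0 1| ^ 2 = 1.
   The indicator function of the cone is omitted, since k and l only range over
   the indices of the cone. *)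
Definition phi (K : realType) (R N : nat) (W0 : K -> K[i]) (V0 : K -> K)
    (i : cone) (n : int * int) (k l : int) : K[i] :=
  let x := grid_point K R N i k l in
  (weight N x / Num.sqrt (cardset (Rlow N))%:R)%:C
  * phihat R W0 V0 (match i with cone1 => swap x | cone2 => x end)
  * expi2pi (n.1%:~R * (k%:~R / 3) + n.2%:~R * (l%:~R / (N%:R + 1))).

(* Main.v *)
(* On one half-cone the sampling set R_{j,s} turns the exponentials into the
   characters r1 k / L1 + r2 l / L2 of a product of two cyclic groups, and the
   windows restrict (k, l) to a box with sides shorter than L1 and L2 (strictly,
   because the windows vanish at the ends of their supports). The characters are
   thus orthogonal on the support of each window product, and Parseval turns the
   sum over m into the energy of J against the squared windows. The squared
   windows sum to 1, first over the shears and then over the scales: W0 drops out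
   of the partition of unity at the radial samples with k <> 0, since these lie
   outside its support. For the same reason the low-frequency functions see only
   the origin, where W vanishes and the 2(N+1) copies of the origin compensate
   its squared weight 1 / (2(N+1)). *)
Require Import Defs.
From HB Require Import structures.
From mathcomp Require Import all_boot all_order all_algebra.
From mathcomp Require Import finmap complex.
From mathcomp Require Import all_classical all_reals all_analysis.
From mathcomp Require Import ring lra zify.

Set Implicit Arguments.
Unset Strict Implicit.
Unset Printing Implicit Defensive.

Import Order.TTheory GRing.Theory Num.Theory.
Import numFieldNormedType.Exports.

Local Open Scope classical_set_scope.
Local Open Scope ring_scope.
Local Open Scope complex_scope.

(** * Characters of finite cyclic groups *)

Section Exponential.
Context {K : realType}.
Implicit Types s t : K.

Lemma expi2piD s t : expi2pi (s + t) = expi2pi s * expi2pi t.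
Proof.
rewrite /expi2pi mulrDr cosD sinD; apply/eqP.
by rewrite eq_complex /= eqxx /=; apply/eqP; ring.
Qed.

Lemma expi2pi0 : expi2pi (0 : K) = 1.
Proof. by rewrite /expi2pi mulr0 cos0 sin0. Qed.

Lemma expi2piN t : expi2pi (- t) = (expi2pi t)^*%R.
Proof. by rewrite /expi2pi mulrN cosN sinN. Qed.

Lemma expi2piMn (n : nat) t : expi2pi (n%:R * t) = expi2pi t ^+ n.
Proof.
elim: n => [|n IHn]; first by rewrite mul0r expi2pi0.
by rewrite -natr1 mulrDl mul1r expi2piD IHn exprSr.
Qed.

Lemma expi2pi_int (d : int) : expi2pi (d%:~R : K) = 1.
Proof.
have expi2pi1 : expi2pi (1 : K) = 1.
  by rewrite /expi2pi mulr1 mulr_natl cos2pi sin2pi.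
case: d => n; first by rewrite -pmulrn -[_%:R]mulr1 expi2piMn expi2pi1 expr1n.
rewrite NegzE mulrNz -pmulrn expi2piN -[_%:R]mulr1 expi2piMn expi2pi1.
by rewrite expr1n rmorph1.
Qed.

(** The real part is [1 - 2 * sin (pi * t) ^+ 2], and the sine is positive for [0 < t < 1]; negative
    [t] follow by conjugation. *)
Lemma expi2pi_neq1 t : 0 < `|t| < 1 -> expi2pi t != 1.
Proof.
wlog t_gt0 : t / 0 < t => [hw|].
  have [->|t_neq0] := eqVneq t 0; first by rewrite normr0 ltxx.
  have [|t_le0] := ltP 0 t; first exact: hw.
  have t_lt0 : 0 < - t by rewrite oppr_gt0 lt_neqAle t_neq0.
  move=> t_bnd; have := hw _ t_lt0; rewrite normrN => /(_ t_bnd).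
  by rewrite expi2piN; apply: contra => /eqP ->; rewrite rmorph1.
rewrite gtr0_norm // => /andP[_ t_lt1]; apply/negP.
rewrite eq_complex /= => /andP[/eqP cos1 _].
have : 0 < sin (pi * t).
  apply: sin_gt0_pi; rewrite mulr_gt0 ?pi_gt0 //=.
  by rewrite -[ltRHS]mulr1 ltr_pM2l ?pi_gt0.
have : cos (2 * pi * t) = 1 - 2 * sin (pi * t) ^+ 2.
  have -> : 2 * pi * t = pi * t + pi * t by ring.
  by rewrite cosD -!expr2 cos2sin2; ring.
by rewrite cos1; nra.
Qed.

(** The bound on [d] leaves 0 as the only multiple of [L], so for every other [d] the summands are
    powers of an [L]-th root of unity different from 1. *)
Lemma sum_expi2pi (L : nat) (d : int) : (`|d| < L)%N ->
  \sum_(r < L) expi2pi (r%:R * (d%:~R / L%:R) : K)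
  = if d == 0 then L%:R else 0.
Proof.
move=> dL; have L_gt0 : (0 < L%:R :> K) by rewrite ltr0n (leq_ltn_trans _ dL).
have [->|d_neq0] := eqVneq d 0.
  under eq_bigr do rewrite mul0r mulr0 expi2pi0.
  by rewrite sumr_const card_ord.
under eq_bigr do rewrite expi2piMn.
set z := expi2pi _; have z_neq1 : z != 1.
  apply: expi2pi_neq1; rewrite normrM normfV (gtr0_norm L_gt0).
  rewrite divr_gt0 ?normr_gt0 ?intr_eq0 //= ltr_pdivrMr // mul1r.
  by rewrite -intr_norm pmulrn ltr_int -ltz_nat abszE in dL *.
have zL : z ^+ L = 1.
  by rewrite -expi2piMn mulrC divfK ?gt_eqF // expi2pi_int.
(* Multiplied by [z - 1], the sum telescopes to [z ^+ L - 1], which is zero. *)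
apply: (mulfI (x := z - 1)); first by rewrite subr_eq0.
by rewrite -subrX1 zL subrr mulr0.
Qed.

End Exponential.

(** * Parseval's identity and finite sums *)

(** Orthogonality is asked only where the coefficients are nonzero: this is how the window supports
    enter, since the exponentials need not be orthogonal over the whole grid. *)
Lemma parseval (K : realType) (M I : choiceType) (B : set M) (A : set I)
    (e : M -> I -> K[i]) (c : I -> K[i]) (S : K[i]) :
  finite_set A -> finite_set B ->
  (forall p q, A p -> A q -> c p != 0 -> c q != 0 ->
     \sum_(m \in B) (e m p)^* * e m q = if p == q then S else 0) ->
  \sum_(m \in B) `|\sum_(p \in A) c p * (e m p)^*| ^+ 2
  = S * \sum_(p \in A) `|c p| ^+ 2.
Proof.
move=> finA finB orth.
transitivity (\sum_(p \in A) \sum_(q \in A)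
                c p * (c q)^* * \sum_(m \in B) (e m p)^* * e m q).
  rewrite [RHS]fsbig_finite // [LHS]fsbig_finite //=.
  under [RHS]eq_bigr do rewrite fsbig_finite //=.
  transitivity (\sum_(m <- fset_set B) \sum_(p <- fset_set A)
      \sum_(q <- fset_set A) c p * (c q)^* * ((e m p)^* * e m q)).
    apply: eq_bigr => m _; rewrite fsbig_finite //= sqr_normc rmorph_sum /=.
    rewrite mulr_suml; apply: eq_bigr => p _; rewrite mulr_sumr.
    by apply: eq_bigr => q _; rewrite rmorphM /= conjcK; ring.
  rewrite exchange_big /=; apply: eq_bigr => p _.
  rewrite exchange_big /=; apply: eq_bigr => q _.
  by rewrite fsbig_finite //= mulr_sumr.
rewrite mulr_fsumr; apply: eq_fsbigr => p /set_mem Ap.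
rewrite (fsbigD1 p) //= [X in _ + X]fsbig1 => [|q [Aq /eqP q_neq_p]].
  rewrite addr0; have [->|cp] := eqVneq (c p) 0.
    by rewrite !mul0r normr0 expr0n mulr0.
  by rewrite orth // eqxx sqr_normc mulrC.
have [->|cp] := eqVneq (c p) 0; first by rewrite !mul0r.
have [->|cq] := eqVneq (c q) 0; first by rewrite rmorph0 mulr0 mul0r.
by rewrite orth // eq_sym (negbTE q_neq_p) mulr0.
Qed.

Lemma fsbig_image2_ord (V : nmodType) (T : choiceType) (a b : nat)
    (f : nat -> nat -> T) (F : T -> V) :
  {in `I_a &, forall i i', {in `I_b &, forall j j',
     f i j = f i' j' -> i = i' /\ j = j'}} ->
  \sum_(m \in [set f i j | i in `I_a & j in `I_b]) F m
  = \sum_(i < a) \sum_(j < b) F (f i j).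
Proof.
move=> f_inj; rewrite image2E fsbig_image.
  transitivity (\sum_(i \in `I_a) \sum_(j \in `I_b) F (f i j)).
    by rewrite pair_fsbig //; apply: eq_fsbigr => -[].
  by rewrite -fsbig_ord; apply: eq_bigr => i _; rewrite -fsbig_ord.
move=> [i j] [i' j'] /set_mem[/= ia jb] /set_mem[/= ia' jb'] /= eq_f.
by have [] := f_inj i i' _ _ j j' _ _ eq_f; rewrite ?inE // => -> ->.
Qed.

Lemma finite_int_interval (a b : int) : finite_set [set k : int | a <= k <= b].
Proof.
apply: (sub_finite_set _ (finite_image (fun n : nat => a + n%:Z)
  (finite_II `|b - a|.+1))).
by move=> k /= /andP[ak kb]; exists `|(k - a)%R|%N => /=; lia.
Qed.

(** Through this, the reindexing of sums also gives the sizes of [Rjs] and [Rlow]. *)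
Lemma cardset_sum (T : choiceType) (A : set T) : finite_set A ->
  cardset A = \sum_(x \in A) 1%N.
Proof.
move=> finA; rewrite fsbig_finite //= big_const_seq /cardset.
by elim: (fset_set A : seq T) => //= x s ->.
Qed.

(** * Orthogonality of the exponentials over the sampling sets *)

Section SamplingSet.
Context {K : realType} (R N : nat).
Hypotheses (R_gt0 : (0 < R)%N) (N_gt0 : (0 < N)%N).
Let R_neq0 : R%:R != 0 :> K. Proof. by rewrite pnatr_eq0 -lt0n. Qed.
Let N_neq0 : N%:R != 0 :> K. Proof. by rewrite pnatr_eq0 -lt0n. Qed.

Lemma sum_Rjs (V : nmodType) (j s : int) (F : K * K -> V) :
  \sum_(m \in Rjs K R N j s) F m
  = \sum_(r1 < L1 K R N j) \sum_(r2 < L2 K N j s)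
      F ((L1 K R N j)%:R^-1 * 4 ^ j * (R%:R / 2) * r1%:R,
         - ((L2 K N j s)%:R^-1 * (N%:R / 2 ^ (j + 1)) * r2%:R)).
Proof.
apply: fsbig_image2_ord => i i' /set_mem /= iL _ r r' /set_mem /= rL _ [].
(* The index [i] below [L1] makes [L1] positive, so the multiplier of [r1] can be cancelled;
   likewise for [L2]. *)
have L1_neq0 : (L1 K R N j)%:R != 0 :> K.
  by rewrite pnatr_eq0 -lt0n (leq_ltn_trans _ iL).
have L2_neq0 : (L2 K N j s)%:R != 0 :> K.
  by rewrite pnatr_eq0 -lt0n (leq_ltn_trans _ rL).
have c1_neq0 : (L1 K R N j)%:R^-1 * 4 ^ j * (R%:R / 2) != 0 :> K.
  by rewrite !mulf_neq0 ?invr_eq0 ?expfz_neq0 ?L1_neq0 ?L2_neq0 ?R_neq0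
    ?N_neq0 ?pnatr_eq0.
have c2_neq0 : (L2 K N j s)%:R^-1 * (N%:R / 2 ^ (j + 1)) != 0 :> K.
  by rewrite !mulf_neq0 ?invr_eq0 ?expfz_neq0 ?L1_neq0 ?L2_neq0 ?R_neq0
    ?N_neq0 ?pnatr_eq0.
move=> /(mulfI c1_neq0) /eqP + /oppr_inj /(mulfI c2_neq0) /eqP.
by rewrite !eqr_nat => /eqP -> /eqP ->.
Qed.

Lemma finite_Rjs (j s : int) : finite_set (Rjs K R N j s).
Proof. by apply: finite_image2; exact: finite_II. Qed.

Lemma cardset_Rjs (j s : int) :
  cardset (Rjs K R N j s) = (L1 K R N j * L2 K N j s)%N.
Proof.
rewrite cardset_sum ?sum_Rjs; last exact: finite_Rjs.
by rewrite !big_const_ord !iter_addr_0 -mulrnA mulnC natn.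
Qed.

Definition phase (j : int) (m x : K * K) : K :=
  m.1 * (4 ^ (- j) * x.1) + m.2 * (2 ^ j * (x.2 / x.1)).

Lemma grid_point2_slope (k l : int) : k != 0 ->
  (grid_point K R N cone2 k l).2 / (grid_point K R N cone2 k l).1
  = - (2 * l%:~R / N%:R).
Proof.
by move=> k_neq0; rewrite /=; field; rewrite N_neq0 R_neq0 intr_eq0 k_neq0.
Qed.

Lemma sum_phase (j s k l k' l' : int) : k != 0 -> k' != 0 ->
  (`|k' - k| < L1 K R N j)%N -> (`|l' - l| < L2 K N j s)%N ->
  \sum_(m \in Rjs K R N j s)
     (expi2pi (phase j m (grid_point K R N cone2 k l)))^*
     * expi2pi (phase j m (grid_point K R N cone2 k' l'))
  = if (k == k') && (l == l') then (cardset (Rjs K R N j s))%:R else 0.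
Proof.
move=> k_neq0 k'_neq0 kL lL; rewrite sum_Rjs.
have L1_neq0 : (L1 K R N j)%:R != 0 :> K.
  by rewrite pnatr_eq0 -lt0n (leq_ltn_trans _ kL).
have L2_neq0 : (L2 K N j s)%:R != 0 :> K.
  by rewrite pnatr_eq0 -lt0n (leq_ltn_trans _ lL).
(* The factors [4 ^ j * (R / 2)] and [- N / 2 ^ (j + 1)] of the sampling point cancel against the
   radius [2k / R] and the slope [- 2l / N]. *)
transitivity ((\sum_(r1 < L1 K R N j)
    expi2pi (r1%:R * ((k' - k)%:~R / (L1 K R N j)%:R) : K))
  * (\sum_(r2 < L2 K N j s)
    expi2pi (r2%:R * ((l' - l)%:~R / (L2 K N j s)%:R) : K))).
  rewrite mulr_suml; apply: eq_bigr => r1 _.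
  rewrite mulr_sumr; apply: eq_bigr => r2 _.
  rewrite -expi2piN -!expi2piD /phase !grid_point2_slope //; congr expi2pi.
  rewrite /= !rmorphB /= expfzDr // -[4 ^ (- j)]invr_expz.
  have e4 : (4 : K) ^ j != 0 by rewrite expfz_neq0.
  have e2 : (2 : K) ^ j != 0 by rewrite expfz_neq0.
  field.
  by rewrite e4 e2 L1_neq0 L2_neq0 N_neq0 R_neq0.
rewrite !sum_expi2pi // !subr_eq0 cardset_Rjs natrM [k == k']eq_sym.
rewrite [l == l']eq_sym.
by case: eqP => _ /=; case: eqP => _ /=; rewrite ?mulr0 ?mul0r.
Qed.

End SamplingSet.

(** * Supports and partitions of unity of the windows *)

Section Windows.
Context {K : realType}.

(** [supp] is a closure, so bounding it leaves the values at the endpoints open; the prescribed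
    zeros settle [|x| = a]. *)
Lemma supp_itv_eq0 (T : nmodType) (f : K -> T) (a x : K) :
  supp f `<=` `[- a, a] -> f a = 0 -> f (- a) = 0 -> a <= `|x| -> f x = 0.
Proof.
move=> f_supp fa fNa a_le_x; apply: contrapT => /eqP fx_neq0.
have /f_supp : supp f x by apply: subset_closure.
rewrite /= in_itv /= -ler_norml => x_le_a.
have : `|x| == a by rewrite eq_le x_le_a.
have a_ge0 : 0 <= a by rewrite (le_trans _ x_le_a).
by rewrite eqr_norml a_ge0 andbT => /orP[] /eqP ex;
  rewrite ex ?fa ?fNa eqxx in fx_neq0.
Qed.

Lemma annulus_window_neq0 (T : nmodType) (W : K -> T) (x : K) :
  supp W `<=` `[-4, -4^-1] `|` `[4^-1, 4] -> W 4^-1 = 0 -> W 4 = 0 ->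
  0 <= x -> W x != 0 -> 4^-1 < x < 4.
Proof.
move=> W_supp W0 W4 x_ge0 Wx.
have : supp W x by apply: subset_closure.
move=> /W_supp [] /=; rewrite in_itv /= => /andP[x_lb x_ub].
  by have := le_trans x_ge0 x_ub; rewrite oppr_ge0 leNgt invr_gt0 ltr0n.
rewrite !lt_neqAle x_lb x_ub !andbT; apply/andP; split.
  by apply: contra Wx => /eqP <-; rewrite W0.
by apply: contra Wx => /eqP ->; rewrite W4.
Qed.

(** Applied to [x = R / 2], this reads [R / 2 <= 4 ^ (- jL)]. *)
Lemma le_exp_ceil_log4 (x : K) : 0 < x -> x <= 4 ^ Num.ceil (log4 x).
Proof.
move=> x_gt0; rewrite -powR_intmul // -ler_ln ?posrE ?powR_gt0 // ln_powR.
have ln4 : 0 < ln (4 : K) by rewrite ln_gt0 // ltr1n.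
by rewrite -ler_pdivrMr //; have /andP[] := ceil_itv (log4 x).
Qed.

(** Only the floor [n] of [- t] and [n + 1] can bring [s + t] strictly between -1 and 1. The
    partition of unity is used at [u = n + t], which lies in (-1, 0], so its term at [u - 1]
    vanishes. *)
Lemma sum_shears (A : pzSemiRingType) (F : K -> A) (j : int) (t : K) :
  (forall u, 1 <= `|u| -> F u = 0) ->
  (forall u, `|u| <= 1 -> F (u - 1) + F u + F (u + 1) = 1) ->
  0 <= j -> `|t| <= 2 ^ j -> \sum_(s \in shears j) F (s%:~R + t) = 1.
Proof.
move=> F_out F_part j_ge0; set n : int := Num.floor (- t).
have /andP[n_le n_gt] := floor_itv (- t); rewrite -/n in n_le n_gt.
have pow2 : (2 ^ j : K) = (2 ^ j : int)%:~R by rewrite -exprz_pintl.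
rewrite pow2 ler_norml => /andP[t_lb t_ub].
rewrite /shears j_ge0; move: (2 ^ j : int) t_lb t_ub => p t_lb t_ub.
have n_out (s : int) : s != n -> s != n + 1 -> 1 <= `|s%:~R + t|.
  move=> sn sn1; have [s_lt|n_lt] := leP s (n - 1).
    have : s%:~R <= (n - 1)%:~R :> K by rewrite ler_int.
    by rewrite rmorphB /= => ?; rewrite ler0_norm; lra.
  have : (n + 2)%:~R <= s%:~R :> K by rewrite ler_int; lia.
  by rewrite rmorphD /= in n_gt * => ?; rewrite ger0_norm; lra.
set S := [set s : int | _].
have n_in : S n.
  rewrite /S /=; apply/andP; split; last by rewrite -(ler_int K); lra.
  have : (- p)%:~R < (n + 1)%:~R :> K by rewrite rmorphN /=; lra.
  by rewrite ltr_int ltzD1.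
(* The shear [n + 1] leaves the range only if [n = 2 ^ j = - t]; its argument is then 1, where [F]
   vanishes. *)
have n1_out : ~ S (n + 1) -> 1 <= `|(n + 1)%:~R + t|.
  move=> /negP n1S; have : p%:~R < (n + 1)%:~R :> K.
    by rewrite ltr_int; move: n1S n_in; rewrite /S /=; lia.
  rewrite ltr_int => jn; have : p%:~R <= n%:~R :> K.
    by rewrite ler_int; lia.
  by rewrite rmorphD /= => ?; rewrite ger0_norm; lra.
rewrite (fsbig_widen _ (S `|` [set n; n + 1])) //=; last first.
  by move=> s [[//|[->|->]]] nS //=; apply: F_out; exact: n1_out.
rewrite -(fsbig_widen [set n; n + 1]) //=; last first.
  move=> s [_ /not_orP[/eqP sn /eqP sn1]] /=.
  by apply: F_out; exact: n_out.
rewrite fsbigU0 ?fsbig_set1 //; last by move=> s [/= ->]; lia.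
rewrite -(F_part (n%:~R + t)); last first.
  by rewrite rmorphD /= in n_gt; rewrite ler_norml; lra.
rewrite [F (_ - 1)]F_out ?add0r; last first.
  by rewrite ler0_norm; lra.
by rewrite rmorphD /= addrAC.
Qed.

End Windows.

(** * Widths of the window supports against the sampling counts *)

Lemma natdiv2_le (K : realType) (n : nat) (k : int) :
  k <= (n %/ 2)%N%:Z -> k%:~R <= n%:R / 2 :> K.
Proof.
move=> k_le; rewrite ler_pdivlMr //.
have : k * 2 <= n%:Z by lia.
by rewrite -(ler_int K) rmorphM.
Qed.

(** The support keeps [k] between [4 ^ (j - 1) * R / 2] and [4 ^ (j + 1) * R / 2]. At the coarsest
    scale [k >= 1] serves as lower end, at the finest [k <= R * N / 2] as upper end; hence the three
    cases of [L1]. *)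
Lemma radial_support_gap (K : realType) (R N : nat) (j k k' : int) :
  (0 < R)%N ->
  1 <= k <= ((R * N) %/ 2)%N%:Z -> 1 <= k' <= ((R * N) %/ 2)%N%:Z ->
  4^-1 < 4 ^ (- j) * (2 * k%:~R / R%:R : K) < 4 ->
  4^-1 < 4 ^ (- j) * (2 * k'%:~R / R%:R : K) < 4 ->
  (`|k' - k| < L1 K R N j)%N.
Proof.
move=> R_gt0; wlog le_kk' : k k' / k <= k' => [hw|].
  have [/hw //|k'k kP k'P Wk Wk'] := leP k k'.
  by rewrite distnC; apply: hw => //; exact: ltW.
move=> /andP[k_ge1 k_le] /andP[k'_ge1 k'_le].
move=> /andP[k_lb _] /andP[_ k'_ub].
have ej : (0 : K) < 4 ^ j by rewrite exprz_gt0.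
have R_gt0' : (0 : K) < R%:R by rewrite ltr0n.
have X_gt0 : 0 < 4 ^ j * (R%:R / 2) :> K by rewrite mulr_gt0 ?divr_gt0.
have {}k_lb : 4 ^ j / 4 * (R%:R / 2) < k%:~R :> K.
  rewrite -invr_expz in k_lb.
  have e : k%:~R = ((4 ^ j)^-1 * (2 * k%:~R / R%:R)) * (4 ^ j * (R%:R / 2)) :> K.
    by field; rewrite !gt_eqF.
  by move: k_lb; rewrite -(ltr_pM2r X_gt0) -e; lra.
have {}k'_ub : k'%:~R < 4 ^ j * 4 * (R%:R / 2) :> K.
  rewrite -invr_expz in k'_ub.
  have e : k'%:~R = ((4 ^ j)^-1 * (2 * k'%:~R / R%:R)) * (4 ^ j * (R%:R / 2)) :> K.
    by field; rewrite !gt_eqF.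
  by move: k'_ub; rewrite -(ltr_pM2r X_gt0) -e; lra.
have {}k'_le : k'%:~R <= R%:R * N%:R / 2 :> K by rewrite -natrM natdiv2_le.
have k_ge1' : 1%:~R <= k%:~R :> K by rewrite ler_int.
(* The gap is below the integer part exactly when its successor is at most the untruncated value, so
   rounding costs nothing. *)
rewrite /L1 truncn_gt_nat -natr1.
have -> : `|k' - k|%:R = k'%:~R - k%:~R :> K.
  by rewrite -rmorphB /= pmulrn gez0_abs // subr_ge0.
rewrite !expfzDr //.
case: eqP => _; first by lra.
by case: eqP => _; rewrite exprN1; lra.
Qed.

(** For [j >= 0] the condition keeps [l] within [N / 2 ^ (j + 1)] of the centre
    [s * N / 2 ^ (j + 1)]. For [j < 0] the range of [angular N] alone bounds the gap by [N]. *)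
Lemma angular_support_gap (K : realType) (N : nat) (j s l l' : int) :
  (0 < N)%N ->
  shears j s -> angular N l -> angular N l' ->
  (0 <= j -> `|s%:~R - 2 ^ j * (2 * l%:~R / N%:R : K)| < 1) ->
  (0 <= j -> `|s%:~R - 2 ^ j * (2 * l'%:~R / N%:R : K)| < 1) ->
  (`|l' - l| < L2 K N j s)%N.
Proof.
move=> N_gt0; wlog le_ll' : l l' / l <= l' => [hw|].
  have [/hw //|l'l sP lP l'P Vl Vl'] := leP l l'.
  by rewrite distnC; apply: hw => //; exact: ltW.
move=> sP /andP[l_lb l_ub] /andP[l'_lb l'_ub] Vl Vl'.
rewrite /L2 truncn_gt_nat -natr1.
have -> : `|l' - l|%:R = l'%:~R - l%:~R :> K.
  by rewrite -rmorphB /= pmulrn gez0_abs // subr_ge0.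
have {}l'_ub : l'%:~R <= N%:R / 2 :> K by exact: natdiv2_le.
have {}l_lb : - l%:~R <= N%:R / 2 :> K.
  by rewrite -rmorphN /=; apply: natdiv2_le; lia.
case: ltP => [_|j_ge0]; first by lra.
have := Vl' j_ge0; have := Vl j_ge0; rewrite !ltr_norml.
move=> /andP[Vl1 Vl2] /andP[Vl'1 Vl'2] {Vl Vl'}.
have N_gt0' : (0 : K) < N%:R by rewrite ltr0n.
have ej : (0 : K) < 2 ^ j by rewrite exprz_gt0.
have el (i : int) :
    i%:~R = (2 ^ j)^-1 * (N%:R / 2) * (2 ^ j * (2 * i%:~R / N%:R)) :> K.
  by field; rewrite !gt_eqF.
rewrite -!invr_expz.
set h := (2 ^ j : K)^-1; have h_gt0 : 0 < h * (N%:R / 2).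
  by rewrite mulr_gt0 ?divr_gt0 ?invr_gt0.
have pow2 : (2 ^ j : K) = (2 ^ j : int)%:~R by rewrite -exprz_pintl.
have N2 : N%:R / 2 = h * (N%:R / 2) * 2 ^ j by rewrite /h; field; rewrite gt_eqF.
(* At an extreme shear the centre is [N / 2] or [- N / 2], so the range of [l] cuts off half of the
   interval; hence the halved count. *)
case: eqP => [/eqP|_].
  rewrite eqr_norml => /andP[/orP[] /eqP es _];
    rewrite es ?rmorphN /= -?pow2 in Vl1 Vl2 Vl'1 Vl'2.
  - have : h * (N%:R / 2) * (2 ^ j - 1) < l%:~R :> K.
      by rewrite (el l) ltr_pM2l //; lra.
    by lra.
  - have : l'%:~R < h * (N%:R / 2) * (1 - 2 ^ j):> K.
      by rewrite (el l') ltr_pM2l //; lra.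
    by lra.
have : h * (N%:R / 2) * (s%:~R - 1) < l%:~R :> K.
  by rewrite (el l) ltr_pM2l //; lra.
have : l'%:~R < h * (N%:R / 2) * (s%:~R + 1) :> K.
  by rewrite (el l') ltr_pM2l //; lra.
by lra.
Qed.

(** * Geometry and symmetries of the pseudo-polar grid *)

Section Grid.
Context {K : realType} (R N : nat).
Implicit Types (x : K * K) (h : halfcone).

Lemma finite_radial : finite_set (radial R N).
Proof. exact: finite_int_interval. Qed.

Lemma finite_angular : finite_set (angular N).
Proof. exact: finite_int_interval. Qed.

Lemma finite_Omega : finite_set (Omega K R N).
Proof.
rewrite finite_setU; split; apply: finite_image2;
  (exact: finite_radial || exact: finite_angular).
Qed.

Lemma to_cone21K h : involutive (@to_cone21 K h).
Proof. by case: h => -[a b]; rewrite /to_cone21 /swap /= ?opprK. Qed.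

Lemma weight_to_cone21 h x : weight N (to_cone21 h x) = weight N x.
Proof.
case: h x => -[a b]; rewrite /weight /to_cone21 /swap /= ?normrN //.
- by rewrite !xpair_eqE andbC (eq_sym `|b|).
- by rewrite !xpair_eqE !oppr_eq0 andbC (eq_sym `|b|).
- by rewrite !xpair_eqE !oppr_eq0.
Qed.

(** The maps are composed of the exchange of coordinates, which exchanges the cones, and the central
    reflection, which turns [k] into [- k]. *)
Lemma Omega_to_cone21 h x : Omega K R N x -> Omega K R N (to_cone21 h x).
Proof.
have oppR (k : int) : radial R N k -> radial R N (- k) by rewrite /radial /=; lia.
have opp_pt i k l : grid_point K R N i (- k) l =
    (- (grid_point K R N i k l).1, - (grid_point K R N i k l).2).
  by case: i; rewrite /= !rmorphN /=; congr pair; ring.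
have swap_pt k l :
    swap (grid_point K R N cone1 k l) = grid_point K R N cone2 k l by [].
have swap_pt' k l :
    swap (grid_point K R N cone2 k l) = grid_point K R N cone1 k l by [].
case=> -[k kP [l lP <-]]; case: h.
- by right; exists k => //; exists l.
- by right; exists (- k); [exact: oppR|exists l; rewrite // opp_pt].
- by left; exists k => //; exists l.
- by left; exists (- k); [exact: oppR|exists l; rewrite // opp_pt].
- by left; exists k => //; exists l.
- by left; exists (- k); [exact: oppR|exists l; rewrite // opp_pt].
- by right; exists k => //; exists l.
- by right; exists (- k); [exact: oppR|exists l; rewrite // opp_pt].
Qed.

Hypotheses (R_gt0 : (0 < R)%N) (N_gt0 : (0 < N)%N).

Lemma grid_point2_inj (k l k' l' : int) : k != 0 ->
  grid_point K R N cone2 k l = grid_point K R N cone2 k' l' -> k = k' /\ l = l'.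
Proof.
move=> k_neq0 eq_pt.
have R_neq0 : R%:R != 0 :> K by rewrite pnatr_eq0 -lt0n.
have N_neq0 : N%:R != 0 :> K by rewrite pnatr_eq0 -lt0n.
have eq_k : k = k'.
  have := congr1 fst eq_pt => /= /(divIf R_neq0) /(mulfI _).
  by rewrite pnatr_eq0 => /(_ isT) /eqP; rewrite eqr_int => /eqP.
have := congr1 (fun x : K * K => x.2 / x.1) eq_pt.
rewrite !grid_point2_slope -?eq_k // => /oppr_inj /(divIf N_neq0) /(mulfI _).
by rewrite pnatr_eq0 => /(_ isT) /eqP; rewrite eqr_int => /eqP.
Qed.

Lemma angular_slope_le1 (l : int) : angular N l -> `|2 * l%:~R / N%:R : K| <= 1.
Proof.
move=> /andP[l_lb l_ub]; have N_gt0' : (0 : K) < N%:R by rewrite ltr0n.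
have := @natdiv2_le K N l l_ub; have := @natdiv2_le K N (- l).
rewrite rmorphN /= lerNl => /(_ l_lb) ? ?.
by rewrite ler_norml ler_pdivlMr // ler_pdivrMr //; lra.
Qed.

Hypothesis N_even : ~~ odd N.

(** The inequalities do not depend on the cone from which a grid point comes. The critical case is a
    [cone1] point in the sector: it lies on a seam and needs new indices in [cone2]. *)
Lemma Omega21_sector x : Omega K R N x ->
  Omega21 K R N x <-> 0 < x.1 /\ `|x.2| <= x.1.
Proof.
have R_gt0' : (0 : K) < R%:R by rewrite ltr0n.
have N_gt0' : (0 : K) < N%:R by rewrite ltr0n.
have r_gt0 (k : int) : (0 < 2 * k%:~R / R%:R :> K) = (0 < k).
  by rewrite pmulr_lgt0 ?invr_gt0 // pmulr_rgt0 ?ltr0z.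
move=> Ox; split.
  case=> k /andP[k_ge1 _] [l lP <-] /=; have k_gt0 : 0 < 2 * k%:~R / R%:R :> K.
    by rewrite r_gt0; lia.
  split=> //; rewrite normrN normrM gtr0_norm // -[leRHS]mulr1.
  by rewrite ler_pM2l // angular_slope_le1.
move: Ox => [] [k kP [l lP <-]] /= [x_gt0 x_le]; last first.
  rewrite r_gt0 in x_gt0; exists k => //=; last by exists l.
  by move: kP; rewrite /radial /=; lia.
have t_le1 := angular_slope_le1 lP.
set r : K := 2 * k%:~R / R%:R in x_gt0 x_le *.
set t : K := 2 * l%:~R / N%:R in t_le1 x_gt0 x_le *.
(* The sector condition gives [|r| <= - (r * t)], and [|t| <= 1] the converse: a seam point. *)
have eq_r : - (r * t) = `|r|.
  apply/eqP; rewrite eq_le x_le andbT (le_trans (ler_norm _)) //.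
  by rewrite normrN normrM ler_piMr.
have half : ((N %/ 2)%N%:Z)%:~R = N%:R / 2 :> K.
  rewrite -pmulrn; apply: (mulIf (x := 2)) => //.
  by rewrite divfK // -natrM divnK // dvdn2.
have lN : angular N (N %/ 2)%N%:Z by rewrite /angular /=; lia.
have lNn : angular N (- (N %/ 2)%N%:Z) by rewrite /angular /=; lia.
(* The point is [(|r|, r)], reached in [cone2] at [(k, - N / 2)] for [r > 0] and at [(- k, N / 2)]
   for [r < 0]; evenness of [N] gives these angular indices slope exactly 1 or -1. *)
have [r_pos|r_neg|r0] := ltrgt0P r.
- exists k => /=; first by move: kP; rewrite r_gt0 in r_pos; rewrite /radial /=; lia.
  exists (- (N %/ 2)%N%:Z) => //; rewrite rmorphN /= half eq_r gtr0_norm //.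
  by congr pair; rewrite /r; field; rewrite !gt_eqF.
- exists (- k) => /=.
    move: kP r_neg; rewrite -oppr_gt0 -mulNr -mulrN -rmorphN r_gt0 /radial /=.
    by lia.
  exists ((N %/ 2)%N%:Z) => //; rewrite rmorphN /= half eq_r ltr0_norm //.
  by congr pair; rewrite /r; field; rewrite !gt_eqF.
- by rewrite r0 mul0r oppr0 ltxx in x_gt0.
Qed.

(* A seam point lies in exactly two of the four sectors, any other nonzero
   point in one. *)
Lemma sum_weight_Omega21 x : Omega K R N x -> x != (0, 0) ->
  \sum_(h <- [:: cone11; cone12; cone21; cone22])
    weight N x ^+ 2 * \1_(Omega21 K R N) (to_cone21 h x) = 1 :> K.
Proof.
move=> Ox x_neq0.
have indicP h : \1_(Omega21 K R N) (to_cone21 h x) =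
    ((0 < (to_cone21 h x).1) && (`|(to_cone21 h x).2| <= (to_cone21 h x).1))%:R :> K.
  rewrite indicE; congr (nat_of_bool _)%:R; apply/idP/idP.
    by move=> /set_mem /(Omega21_sector (Omega_to_cone21 h Ox)) [-> ->].
  by move=> /andP ?; apply/mem_set/(Omega21_sector (Omega_to_cone21 h Ox)).
rewrite !big_cons big_nil !indicP {indicP}.
rewrite /weight (negbTE x_neq0); case: x Ox x_neq0 => a b _ /=.
rewrite xpair_eqE => ab_neq0; rewrite !normrN addr0 -!mulrDr -!natrD.
have sqrt2 : (Num.sqrt 2)^-1 ^+ 2 = 2^-1 :> K by rewrite exprVn sqr_sqrtr.
(* Opposite half-cones are merged, leaving two full cones to compare. *)
have half (u v : K) : addn ((0 < u) && (`|v| <= u)) ((0 < - u) && (`|v| <= - u))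
    = (u != 0) && (`|v| <= `|u|).
  by rewrite oppr_gt0; case: (ltrgt0P u) => _ /=;
    rewrite ?addn0 ?add0n.
rewrite addnA !half -!normr_gt0.
have [ab|ba|ab] := ltrgtP `|a| `|b|.
- by rewrite (le_lt_trans _ ab) // andbF expr1n mul1r.
- by rewrite (le_lt_trans _ ba) // andbF expr1n mul1r.
- rewrite ab; have -> : 0 < `|b|.
    by rewrite -ab normr_gt0; apply: contra ab_neq0 => /eqP a0;
      rewrite a0 -(normr_eq0 b) -ab a0 normr0 eqxx.
  by rewrite sqrt2 -[X in X = _]/(2^-1 * 2%:R) mulVf.
Qed.

End Grid.

(** * Energy of the shearlets on one half-cone *)

Section Energy.
Context {K : realType} (R N : nat).
Hypotheses (R_gt0 : (0 < R)%N) (N_gt0 : (0 < N)%N).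
Variable J : K * K -> K[i].

Lemma sqr_norm_real_complex (u : K) : `|u%:C| ^+ 2 = (u ^+ 2)%:C :> K[i].
Proof. by rewrite sqr_normc conjc_real -rmorphM expr2. Qed.

Lemma conj_real_complex (u : K) : (u%:C : K[i])^*%R = u%:C.
Proof. exact: conjc_real. Qed.

Section HalfCone.
Variables (W : K -> K[i]) (V0 V : K -> K).
Hypotheses (W_supp : supp W `<=` `[-4, -4^-1] `|` `[4^-1, 4])
  (W_lo : W 4^-1 = 0) (W_hi : W 4 = 0)
  (V_out : forall u, 1 <= `|u| -> V u = 0).

Lemma sum_sqr_inner_sigma (h : halfcone) (j s : int) : shears j s ->
  \sum_(m \in Rjs K R N j s) `|inner R N J (sigma R N W V0 V h j s m)| ^+ 2
  = \sum_(x \in Omega K R N)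
      let y := to_cone21 h x in
      `|J x| ^+ 2
      * (weight N x ^+ 2 * \1_(Omega21 K R N) y)%:C
      * (`|W (4 ^ (- j) * y.1)| ^+ 2
         * (((if 0 <= j then V else V0) (s%:~R + 2 ^ j * (y.2 / y.1))) ^+ 2)%:C).
Proof.
move=> js; set Vj := if 0 <= j then V else V0.
set B := Rjs K R N j s.
(* [g] gathers the factors that do not depend on [m]; [e] is the exponential, normalised so that the
   constant in [parseval] is 1. *)
pose g x := (weight N x)%:C * W (4 ^ (- j) * (to_cone21 h x).1)
  * (Vj (s%:~R + 2 ^ j * ((to_cone21 h x).2 / (to_cone21 h x).1)))%:C
  * (\1_(Omega21 K R N) (to_cone21 h x))%:C.
pose e m x := ((Num.sqrt (cardset B)%:R)^-1)%:C
  * expi2pi (phase j m (to_cone21 h x)) : K[i].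
transitivity (\sum_(m \in B)
    `|\sum_(x \in Omega K R N) (J x * (g x)^*%R) * (e m x)^*%R| ^+ 2).
  apply: eq_fsbigr => m _; congr (`|_| ^+ 2); apply: eq_fsbigr => x _.
  rewrite -mulrA -rmorphM /=; congr (_ * _^*%R).
  rewrite /g /e /sigma /sigma21 -/Vj -/B weight_to_cone21 rmorphM /=.
  by rewrite -/(phase j m _); ring.
rewrite (parseval (S := 1)); last first.
- have g_neq0 x : J x * (g x)^*%R != 0 -> g x != 0.
    by rewrite mulf_eq0 conjC_eq0 => /norP[].
  move=> p q _ _ /g_neq0 gp /g_neq0 gq.
  (* Nonvanishing of [g] yields indices confined by the windows, as the two gap lemmas require. *)
  have gridP x : g x != 0 -> exists k l : int,
      [/\ 1 <= k <= ((R * N) %/ 2)%N%:Z, angular N l,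
        to_cone21 h x = grid_point K R N cone2 k l,
        4^-1 < 4 ^ (- j) * (2 * k%:~R / R%:R : K) < 4 &
        0 <= j -> `|s%:~R - 2 ^ j * (2 * l%:~R / N%:R : K)| < 1].
    rewrite /g !mulf_eq0 !negb_or => /andP[/andP[/andP[_ Wx] Vx] Ox].
    have : to_cone21 h x \in Omega21 K R N.
      by move: Ox; rewrite indicE; case: (_ \in _); rewrite ?eqxx.
    move=> /set_mem [k kP [l lP eq_x]]; rewrite -eq_x in Wx Vx.
    exists k, l; split=> //.
      apply: annulus_window_neq0 Wx => //.
      rewrite mulr_ge0 ?exprz_ge0 // divr_ge0 // mulr_ge0 // ler0z.
      by move: kP => /=; lia.
    have k_neq0 : k != 0 by move: kP => /=; lia.
    move=> j_ge0; rewrite ltNge; apply: contra Vx => V1.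
    rewrite grid_point2_slope // mulrN /Vj j_ge0 V_out //.
  have [k [l [kP lP eq_p Wk Vl]]] := gridP _ gp.
  have [k' [l' [k'P l'P eq_q Wk' Vl']]] := gridP _ gq.
  have kL := radial_support_gap R_gt0 kP k'P Wk Wk'.
  have lL := angular_support_gap N_gt0 js lP l'P Vl Vl'.
  have k_neq0 : k != 0 by lia.
  have k'_neq0 : k' != 0 by lia.
  have card_gt0 : 0 < (cardset B)%:R :> K.
    by rewrite ltr0n cardset_Rjs // muln_gt0 (leq_ltn_trans _ kL)
       ?(leq_ltn_trans _ lL).
  transitivity ((((cardset B)%:R : K)^-1)%:C * \sum_(m \in B)
      (expi2pi (phase j m (to_cone21 h p)))^*%R
      * expi2pi (phase j m (to_cone21 h q))).
    rewrite mulr_fsumr; apply: eq_fsbigr => m _; rewrite /e rmorphM /=.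
    rewrite conj_real_complex -{3}(sqr_sqrtr (ltW card_gt0)) -exprVn expr2.
    by rewrite rmorphM /=; ring.
  rewrite eq_p eq_q sum_phase //.
  have -> : (k == k') && (l == l') = (p == q).
    apply/andP/eqP => [[/eqP kk' /eqP ll']|pq].
      by rewrite -(to_cone21K h p) eq_p kk' ll' -eq_q to_cone21K.
    move: eq_p; rewrite pq eq_q => /(grid_point2_inj R_gt0 N_gt0 k'_neq0) [-> ->].
    by rewrite !eqxx.
  case: eqP => _; last by rewrite mulr0.
  by rewrite -(rmorph_nat (real_complex K)) -rmorphM mulVf ?gt_eqF.
- exact: finite_Rjs.
- exact: finite_Omega.
rewrite mul1r; apply: eq_fsbigr => x _; rewrite /g -/Vj.
rewrite normrM exprMn norm_conjC !normrM !exprMn !sqr_norm_real_complex.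
have -> : (\1_(Omega21 K R N) (to_cone21 h x) : K) ^+ 2
    = \1_(Omega21 K R N) (to_cone21 h x).
  by rewrite indicE; case: (_ \in _); rewrite ?expr1n ?expr0n.
by rewrite /= rmorphM /=; ring.
Qed.

End HalfCone.
End Energy.

(* The support of W0 therefore meets the radial samples only at the origin. *)
Lemma le1_radial (K : realType) (R : nat) (k : int) : (0 < R)%N -> k != 0 ->
  1 <= `|4 ^ (- jL K R) * (2 * k%:~R / R%:R : K)|.
Proof.
move=> R_gt0 k_neq0; have R_gt0' : (0 : K) < R%:R by rewrite ltr0n.
rewrite /jL opprK; have := @le_exp_ceil_log4 K (R%:R / 2).
rewrite divr_gt0 // => /(_ isT).
move: (4 ^ _) => p p_ge.
have p_ge0 : 0 <= p by rewrite (le_trans _ p_ge) ?divr_ge0.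
have k_ge1 : 1 <= `|k%:~R| :> K.
  by rewrite -intr_norm -[1]/(1%:~R) ler_int; lia.
rewrite !normrM normfV (ger0_norm p_ge0) (ger0_norm (ler0n _ 2)).
rewrite (gtr0_norm R_gt0') (le_trans k_ge1) //.
rewrite [leLHS](_ : _ = R%:R / 2 * (2 * `|k%:~R| / R%:R)); last first.
  by field; rewrite gt_eqF.
by rewrite ler_wpM2r // divr_ge0 // mulr_ge0.
Qed.

(** * Low-frequency functions and the energy at the origin *)

Section LowFrequency.
Context {K : realType} (N : nat).
Hypothesis N_even : ~~ odd N.

Lemma sum_angular (V : nmodType) (F : int -> V) :
  \sum_(l \in angular N) F l = \sum_(r < N.+1) F (r%:Z - (N %/ 2)%N%:Z).
Proof.
rewrite (reindex_fsbig (fun r : nat => r%:Z - (N %/ 2)%N%:Z) `I_N.+1).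
  by rewrite -fsbig_ord.
split=> [r /=|r r' _ _ /addIr [] //|l].
  by rewrite /angular /=; lia.
by rewrite /angular /= => lP; exists `|(l + (N %/ 2)%N%:Z)%R|%N => /=; lia.
Qed.

Lemma sum_Rlow (V : nmodType) (F : int * int -> V) :
  \sum_(n \in Rlow N) F n
  = \sum_(r1 < 3) \sum_(r2 < N.+1) F (r1%:Z - 1, r2%:Z - (N %/ 2)%N%:Z).
Proof.
rewrite -(@fsbig_image2_ord _ _ _ _
  (fun r1 r2 : nat => (r1%:Z - 1, r2%:Z - (N %/ 2)%N%:Z))).
  apply: eq_fsbigl; apply/seteqP; split=> [[a b]|_ [r1 + [r2 + <-]]] /=;
    rewrite /Rlow /=.
    move=> [aP bP]; exists `|(a + 1)%R|%N; first by rewrite /=; lia.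
    by exists `|(b + (N %/ 2)%N%:Z)%R|%N; [rewrite /=; lia|congr pair; lia].
  by move=> r1P r2P; split; lia.
by move=> i i' _ _ r r' _ _ []; lia.
Qed.

Lemma finite_Rlow : finite_set (Rlow N).
Proof.
apply: (sub_finite_set _ (finite_setX (finite_int_interval (-1) 1)
  (finite_int_interval (- (N %/ 2)%N%:Z) (N %/ 2)%N%:Z))).
by move=> [a b].
Qed.

Lemma cardset_Rlow : cardset (Rlow N) = (3 * N.+1)%N.
Proof.
rewrite cardset_sum ?sum_Rlow; last exact: finite_Rlow.
by rewrite !big_const_ord !iter_addr_0 -mulrnA mulnC natn.
Qed.

(** Only [n.2] occurs, as the part [n.1 * k / 3] of the phase vanishes at [k = 0]; the three values
    of [n.1] contribute a factor 3. Shifting [n.2] by [N / 2] contributes a constant factor, equal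
    to 1 when [l = l']. *)
Lemma sum_Rlow_phase (l l' : int) : angular N l -> angular N l' ->
  \sum_(n \in Rlow N) (expi2pi (n.2%:~R * (l%:~R / (N%:R + 1)) : K))^*%R
      * expi2pi (n.2%:~R * (l'%:~R / (N%:R + 1)))
  = if l == l' then (cardset (Rlow N))%:R else 0.
Proof.
move=> lP l'P; rewrite sum_Rlow /=.
pose d := l' - l.
transitivity (\sum_(r1 < 3) expi2pi (- ((N %/ 2)%N%:R * (d%:~R / N.+1%:R))) *
    \sum_(r2 < N.+1) expi2pi (r2%:R * (d%:~R / N.+1%:R) : K)).
  apply: eq_bigr => r1 _; rewrite mulr_sumr; apply: eq_bigr => r2 _.
  rewrite -expi2piN -!expi2piD; congr expi2pi.
  by rewrite /d !rmorphB /= -!pmulrn natr1; ring.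
rewrite sumr_const card_ord sum_expi2pi; last first.
  by move: lP l'P; rewrite /d /angular /=; lia.
rewrite subr_eq0 [l' == l]eq_sym cardset_Rlow.
case: eqP => [ll'|_]; last by rewrite mulr0 mul0rn.
have -> : d = 0 by rewrite /d ll' subrr.
by rewrite mul0r mulr0 oppr0 expi2pi0 mul1r natrM -[_ *+ 3]mulr_natl.
Qed.

(** Only [k = 0] survives, so Parseval runs over the [N + 1] copies of the origin in one cone. Each
    has squared weight [1 / (2 * (N + 1))], whence the factor one half. *)
Lemma sum_sqr_inner_phi (R : nat) (J : K * K -> K[i])
    (W0 : K -> K[i]) (V0 : K -> K) (i : cone) :
  (0 < R)%N -> (forall u, 1 <= `|u| -> W0 u = 0) -> V0 0 = 1 ->
  \sum_(n \in Rlow N) `|inner_cone R N i J (phi R N W0 V0 i n)| ^+ 2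
  = `|J (0, 0)| ^+ 2 * `|W0 0| ^+ 2 / 2.
Proof.
move=> R_gt0 W0_out V0_0.
have grid0 l : grid_point K R N i 0 l = (0, 0).
  by case: i; rewrite /= mulr0 !mul0r oppr0.
have phi_out n k l : k != 0 -> phi R N W0 V0 i n k l = 0.
  move=> k_neq0; rewrite /phi /phihat.
  have -> : (match i with cone1 => swap (grid_point K R N i k l)
      | cone2 => grid_point K R N i k l end).1 = 2 * k%:~R / R%:R by case: i {grid0}.
  by rewrite W0_out ?mul0r ?mulr0 ?mul0r // le1_radial.
have card_gt0 : 0 < (cardset (Rlow N))%:R :> K by rewrite ltr0n cardset_Rlow.
pose w : K := weight N (0, 0).
pose e (n : int * int) (l : int) := ((Num.sqrt (cardset (Rlow N))%:R)^-1)%:C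
  * expi2pi (n.2%:~R * (l%:~R / (N%:R + 1))) : K[i].
transitivity (\sum_(n \in Rlow N)
    `|\sum_(l \in angular N) (J (0, 0) * (w%:C * W0 0)^*%R) * (e n l)^*%R| ^+ 2).
  apply: eq_fsbigr => n _; congr (`|_| ^+ 2); rewrite /inner_cone.
  rewrite (fsbigD1 0); last 2 first.
  - exact: finite_radial.
  - by rewrite /radial /=; lia.
  rewrite /= [X in _ + X]fsbig1 ?addr0; last first.
    move=> k [_ /= /eqP k_neq0]; apply: fsbig1 => l _.
    by rewrite phi_out // rmorph0 mulr0.
  apply: eq_fsbigr => l _; rewrite grid0 -mulrA -rmorphM /=.
  congr (_ * _^*%R); rewrite /phi grid0 /phihat /swap.
  have -> : (match i with cone1 => (((0, 0) : K * K).2, ((0, 0) : K * K).1)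
      | cone2 => (0, 0) end) = (0, 0) by case: i {grid0 phi_out}.
  by rewrite /= !mulr0 V0_0 mul0r mulr0 add0r /e -/w rmorphM /=; ring.
rewrite (parseval (S := 1)); last first.
- move=> l l' lP l'P _ _.
  transitivity ((((cardset (Rlow N))%:R : K)^-1)%:C * \sum_(n \in Rlow N)
      (expi2pi (n.2%:~R * (l%:~R / (N%:R + 1)) : K))^*%R
      * expi2pi (n.2%:~R * (l'%:~R / (N%:R + 1)))).
    rewrite mulr_fsumr; apply: eq_fsbigr => m _; rewrite /e rmorphM /=.
    rewrite conj_real_complex -{3}(sqr_sqrtr (ltW card_gt0)) -exprVn expr2.
    by rewrite rmorphM /=; ring.
  rewrite sum_Rlow_phase //; case: eqP => _; last by rewrite mulr0.
  by rewrite -(rmorph_nat (real_complex K)) -rmorphM mulVf ?gt_eqF.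
- exact: finite_Rlow.
- exact: finite_angular.
rewrite mul1r sum_angular sumr_const card_ord.
rewrite normrM exprMn norm_conjC normrM exprMn sqr_norm_real_complex.
have -> : w ^+ 2 = (2 * N.+1%:R)^-1.
  by rewrite /w /weight eqxx natr1 exprVn sqr_sqrtr.
rewrite fmorphV rmorphM /= !rmorph_nat -mulr_natl.
by field; rewrite ?pnatr_eq0.
Qed.

End LowFrequency.

Lemma finite_shears (j : int) : finite_set (shears j).
Proof. by rewrite /shears; case: ifP => _; [exact: finite_int_interval|]. Qed.

Lemma Omega00 (K : realType) (R N : nat) : Omega K R N (0, 0).
Proof.
right; exists 0; first by rewrite /radial /=; lia.
exists 0; first by rewrite /angular /=; lia.
by rewrite /= !(mulr0, mul0r) oppr0.
Qed.

(** * Shearlet energy away from the origin *)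

Section HighFrequency.
Context {K : realType} (R N : nat).

Hypotheses (R_gt0 : (0 < R)%N) (N_gt0 : (0 < N)%N) (N_even : ~~ odd N).
Variables (W0 W : K -> K[i]) (V0 V : K -> K).
Hypotheses (W_supp : supp W `<=` `[-4, -4^-1] `|` `[4^-1, 4])
  (W_lo : W 4^-1 = 0) (W_hi : W 4 = 0)
  (V_out : forall u, 1 <= `|u| -> V u = 0)
  (V_part : forall u, `|u| <= 1 -> V (u - 1) ^+ 2 + V u ^+ 2 + V (u + 1) ^+ 2 = 1)
  (V0_one : forall u, `|u| <= 1 -> V0 u = 1)
  (W0_out : forall u, 1 <= `|u| -> W0 u = 0)
  (W_part : forall xi : K, `|xi| <= N%:R ->
     `|W0 (4 ^ (- jL K R) * xi)| ^+ 2
     + \sum_(j \in scales K R N) `|W (4 ^ (- j) * xi)| ^+ 2 = 1).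

(** For [j >= 0] the shears cover the range of [2 ^ j * t]. For [j < 0] the only shear is 0, and
    [2 ^ j * t] stays in [[-1, 1]], where [V0] is 1. *)
Lemma sum_shears_window (j : int) (t : K) : `|t| <= 1 ->
  \sum_(s \in shears j)
    (((if 0 <= j then V else V0) (s%:~R + 2 ^ j * t)) ^+ 2)%:C = 1 :> K[i].
Proof.
move=> t_le1; have [j_ge0|j_lt0] := leP 0 j.
  rewrite (sum_shears (F := fun u => (V u ^+ 2)%:C)) //.
  - by move=> u /V_out ->; rewrite expr0n.
  - by move=> u /V_part V1; rewrite -!rmorphD /= V1.
  - rewrite normrM ger0_norm ?exprz_ge0 //.
    by rewrite -[leRHS]mulr1 ler_wpM2l ?exprz_ge0.
rewrite /shears leNgt j_lt0 fsbig_set1 add0r V0_one ?expr1n //.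
rewrite normrM ger0_norm ?exprz_ge0 // -[leRHS]mulr1 ler_pM ?exprz_ge0 //.
by rewrite -[leRHS](expr0z 2) ler_weXz2l ?ler1n // ltW.
Qed.

Lemma sum_radial_windows (k : int) : 1 <= k <= ((R * N) %/ 2)%N%:Z ->
  \sum_(j \in scales K R N) `|W (4 ^ (- j) * (2 * k%:~R / R%:R))| ^+ 2 = 1.
Proof.
move=> kP; have k_neq0 : k != 0 by lia.
have R_gt0' : (0 : K) < R%:R by rewrite ltr0n.
rewrite -(W_part (xi := 2 * k%:~R / R%:R)); last first.
  have /natdiv2_le kN : k <= ((R * N) %/ 2)%N%:Z by lia.
  have k_ge0 : 0 <= k%:~R :> K by rewrite ler0z; lia.
  rewrite ger0_norm ?divr_ge0 ?mulr_ge0 // ler_pdivrMr //.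
  by have := kN K; rewrite natrM; lra.
by rewrite W0_out ?normr0 ?expr0n ?add0r // le1_radial.
Qed.

Lemma sum_sqr_inner_shearlets (J : K * K -> K[i]) :
  \sum_(i <- [:: cone11; cone12; cone21; cone22])
      \sum_(j \in scales K R N) \sum_(s \in shears j) \sum_(m \in Rjs K R N j s)
        `|inner R N J (sigma R N W V0 V i j s m)| ^+ 2
  = \sum_(x \in Omega K R N `\ (0, 0)) `|J x| ^+ 2.
Proof.
have finO := @finite_Omega K R N.
transitivity (\sum_(i <- [:: cone11; cone12; cone21; cone22])
    \sum_(x \in Omega K R N) `|J x| ^+ 2
      * (weight N x ^+ 2 * \1_(Omega21 K R N) (to_cone21 i x))%:C).
  apply: eq_bigr => h _.
  pose a x := `|J x| ^+ 2
      * (weight N x ^+ 2 * \1_(Omega21 K R N) (to_cone21 h x))%:C.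
  pose b j s x := (((if 0 <= j then V else V0)
    (s%:~R + 2 ^ j * ((to_cone21 h x).2 / (to_cone21 h x).1))) ^+ 2)%:C : K[i].
  transitivity (\sum_(j \in scales K R N) \sum_(x \in Omega K R N)
      \sum_(s \in shears j)
        a x * (`|W (4 ^ (- j) * (to_cone21 h x).1)| ^+ 2 * b j s x)).
    apply: eq_fsbigr => j _; rewrite [RHS]exchange_fsbig //;
      last exact: finite_shears.
    by apply: eq_fsbigr => s /set_mem sP; rewrite sum_sqr_inner_sigma.
  rewrite exchange_fsbig //; last exact: finite_int_interval.
  apply: eq_fsbigr => x _; rewrite -/(a x).
  (* Where [a x] vanishes both sides are zero; elsewhere the reflected point has indices with
     [k >= 1], so its slope is [- 2l / N]. *)
  have [ax0|ax] := eqVneq (a x) 0.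
    by rewrite ax0 fsbig1 // => j _; rewrite fsbig1 // => s _; rewrite mul0r.
  have : Omega21 K R N (to_cone21 h x).
    apply: contrapT => nO; move: ax; rewrite /a indicE memNset //.
    by rewrite mulr0 mulr0 eqxx.
  move=> [k kP [l lP eq_x]].
  rewrite -[RHS]mulr1 -(sum_radial_windows kP) mulr_fsumr.
  apply: eq_fsbigr => j _; rewrite -mulr_fsumr -mulr_fsumr /b -eq_x.
  rewrite grid_point2_slope //; last by move: kP => /=; lia.
  by rewrite sum_shears_window ?mulr1 // normrN angular_slope_le1.
transitivity (\sum_(x \in Omega K R N) `|J x| ^+ 2
    * (\sum_(h <- [:: cone11; cone12; cone21; cone22])
         weight N x ^+ 2 * \1_(Omega21 K R N) (to_cone21 h x))%:C).
  under eq_bigr do rewrite fsbig_finite //.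
  rewrite exchange_big fsbig_finite //=; apply: eq_bigr => x _.
  by rewrite rmorph_sum /= mulr_sumr.
(* The origin lies in no half-cone, these requiring a positive first coordinate after reflection. *)
rewrite (fsbigD1 (0, 0)) //=; last exact: Omega00.
rewrite [X in X%:C]big1 => [|h _]; last first.
  rewrite indicE memNset ?mulr0 // => /Omega21_sector.
  case=> //; first exact/Omega_to_cone21/Omega00.
  by case: h; rewrite /= ?oppr0 ltxx.
rewrite rmorph0 mulr0 add0r; apply: eq_fsbigr => x /set_mem[Ox /eqP x_neq0].
by rewrite sum_weight_Omega21 // mulr1.
Qed.
End HighFrequency.

(** * Assembly of the two frequency ranges *)

Theorem theorem2p3 (K : realType) (R N n0 : nat)
  (R_gt0 : (0 < R)%N) (R_even : ~~ odd R)
  (N_gt0 : (0 < N)%N) (N_even : ~~ odd N) (N_pow2 : N = (2 ^ n0)%N)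
  (W0 W : K -> K[i]) (V0 V : K -> K)
  (W0_supp : supp W0 `<=` `[-1, 1])
  (W0_bnd : W0 1 = 0 /\ W0 (-1) = 0)
  (W_supp : supp W `<=` `[-4, -4^-1] `|` `[4^-1, 4])
  (W_bnd : W (4^-1) = 0 /\ W (- 4^-1) = 0 /\ W 4 = 0 /\ W (-4) = 0)
  (W_partition : forall xi : K, `|xi| <= N%:R ->
     `|W0 (4 ^ (- jL K R) * xi)| ^+ 2
     + \sum_(j \in scales K R N) `|W (4 ^ (- j) * xi)| ^+ 2 = 1)
  (V0_bump : bump_function V0)
  (V0_supp : supp V0 `<=` `[- (3 / 2), 3 / 2])
  (V0_one : forall xi : K, `|xi| <= 1 -> V0 xi = 1)
  (V_bump : bump_function V)
  (V_supp : supp V `<=` `[-1, 1])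
  (V_bnd : V 1 = 0 /\ V (-1) = 0)
  (V_partition : forall xi : K, `|xi| <= 1 ->
     `|V (xi - 1)| ^+ 2 + `|V xi| ^+ 2 + `|V (xi + 1)| ^+ 2 = 1)
  (J : K * K -> K[i]) :
  \sum_(i <- [:: cone1; cone2]) \sum_(n \in Rlow N)
     `|inner_cone R N i J (phi R N W0 V0 i n)| ^+ 2
  + \sum_(i <- [:: cone11; cone12; cone21; cone22])
      \sum_(j \in scales K R N) \sum_(s \in shears j) \sum_(m \in Rjs K R N j s)
        `|inner R N J (sigma R N W V0 V i j s m)| ^+ 2
  = inner R N J J.
Proof.
have [W_lo [_ [W_hi _]]] := W_bnd.
have W0_out u : 1 <= `|u| -> W0 u = 0.
  by case: W0_bnd => W01 W0N1; exact: supp_itv_eq0.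
have V_out u : 1 <= `|u| -> V u = 0.
  by case: V_bnd => V1 VN1; exact: supp_itv_eq0.
have V_part u : `|u| <= 1 -> V (u - 1) ^+ 2 + V u ^+ 2 + V (u + 1) ^+ 2 = 1.
  by move=> /V_partition; rewrite !real_normK ?num_real.
(* As 0 lies in the hole of the annulus, the partition of unity there reduces to
   [|W0 0| ^+ 2 = 1]. *)
have W_0 : W 0 = 0.
  apply: contrapT => /eqP /(annulus_window_neq0 W_supp W_lo W_hi (lexx 0)).
  by rewrite ltNge invr_ge0 ler0n.
have W0_0 : `|W0 0| ^+ 2 = 1.
  rewrite -(W_partition 0) ?normr0 // mulr0 fsbig1 ?addr0 // => j _.
  by rewrite mulr0 W_0 normr0 expr0n.
rewrite (sum_sqr_inner_shearlets R_gt0 N_gt0 N_even W_supp W_lo W_hi V_out V_part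
  V0_one W0_out W_partition).
(* Each of the two cones supplies half of the energy at the origin. *)
rewrite !big_cons big_nil !sum_sqr_inner_phi // ?V0_one ?normr0 // W0_0.
rewrite /inner (fsbigD1 (0, 0) (Omega K R N));
  [|exact: finite_Omega|exact: Omega00] => /=.
rewrite mulr1 addr0 -splitr sqr_normc; congr (_ + _).
by apply: eq_fsbigr => x _; rewrite sqr_normc.
Qed.
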